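(* Let $p$ be a prime and $X=\mathbb Z/(p)\times\mathbb Z/(p)$. Let $(X,r)$ be an indecomposable and irretractable solution of the YBE such that $r((i,j),(k,l))=(\sigma_{(i,j)}(k,l),\sigma^{-1}_{\sigma_{(i,j)}(k,l)}(i,j))$ with $\sigma_{(i,j)}(k,l)=(\sigma_j(k),d_{i,\sigma_j(k)}(l))$ for all $i,j,k,l\in\mathbb Z/(p)$, for some maps $\sigma_j,d_{i,k}:\mathbb Z/(p)\to\mathbb Z/(p)$. Then there exist a nonzero $t\in\mathbb Z/(p)$ and elements $j_0,\dots,j_{p-1}\in\mathbb Z/(p)$ with $j_i=j_{-i}$ and $j_{t^s i}=t^s j_i-(t^s-1)j_0$ for all $i\in\mathbb Z/(p)$, $s\in\mathbb Z$, and $j_i\ne j_k$ for some $i\ne k$, such that $(X,r)$ is isomorphic to the solution $(X,r')$ given by $r'((i,j),(k,l))=(\sigma'_{(i,j)}(k,l),(\sigma'_{\sigma'_{(i,j)}(k,l)})^{-1}(i,j))$ with $\sigma'_{(i,j)}(k,l)=(tk+j,\ t(l-j_{tk+j-i}))$. In particular $(X,r)$ is simple.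
   Context: A solution of the YBE is a pair $(X,r)$, $X$ nonempty, $r:X\times X\to X\times X$, $r(x,y)=(\sigma_x(y),\gamma_y(x))$, with $r^2=\mathrm{id}$, all $\sigma_x,\gamma_x$ bijective, and $r_{12}r_{23}r_{12}=r_{23}r_{12}r_{23}$ on $X^3$. Indecomposable: $\langle\sigma_x\rangle\le \mathrm{Sym}_X$ transitive on $X$. Irretractable: $\sigma_x\ne\sigma_y$ for $x\ne y$. An isomorphism of solutions $f:(X,r)\to(Y,s)$ (with $s(t,z)=(\sigma'_t(z),\gamma'_z(t))$) is a bijection with $f(\sigma_x(y))=\sigma'_{f(x)}(f(y))$ for all $x,y$. $(X,r)$ is simple if $|X|>1$ and every surjective homomorphism of solutions from $(X,r)$ is bijective or has one-point image. *)

(* Defs.v *)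
From HB Require Import structures.
From mathcomp Require Import all_boot all_order all_algebra.
From Stdlib Require Import Relations.
Set Implicit Arguments. Unset Strict Implicit. Unset Printing Implicit Defensive.

Definition ybe_sigma (X : Type) (r : X * X -> X * X) (x y : X) : X := (r (x, y)).1.
Definition ybe_gamma (X : Type) (r : X * X -> X * X) (y x : X) : X := (r (x, y)).2.

Definition r12 (X : Type) (r : X * X -> X * X) (t : X * X * X) : X * X * X :=
  let u := r (t.1.1, t.1.2) in (u.1, u.2, t.2).
Definition r23 (X : Type) (r : X * X -> X * X) (t : X * X * X) : X * X * X :=
  let u := r (t.1.2, t.2) in (t.1.1, u.1, u.2).

Definition is_solution (X : Type) (r : X * X -> X * X) : Prop :=
  [/\ (forall z, r (r z) = z),
      (forall x, bijective (ybe_sigma r x)),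
      (forall y, bijective (ybe_gamma r y)) &
      (forall t, r12 r (r23 r (r12 r t)) = r23 r (r12 r (r23 r t)))].

(* orbits of the group generated by the sigma_x: u ~ v iff some sigma_z
   maps u to v or v to u; the group orbit is the reflexive-transitive closure *)
Definition sigma_step (X : Type) (r : X * X -> X * X) (u v : X) : Prop :=
  exists z, ybe_sigma r z u = v \/ ybe_sigma r z v = u.

Definition indecomposable (X : Type) (r : X * X -> X * X) : Prop :=
  forall x y, clos_refl_trans X (sigma_step r) x y.

Definition irretractable (X : Type) (r : X * X -> X * X) : Prop :=
  forall x y, ybe_sigma r x = ybe_sigma r y -> x = y.

Definition sol_hom (X Y : Type) (r : X * X -> X * X) (s : Y * Y -> Y * Y)
  (f : X -> Y) : Prop :=
  forall x y, f (ybe_sigma r x y) = ybe_sigma s (f x) (f y).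

Definition sol_iso (X Y : Type) (r : X * X -> X * X) (s : Y * Y -> Y * Y)
  (f : X -> Y) : Prop := bijective f /\ sol_hom r s f.

Definition simple_solution (X : Type) (r : X * X -> X * X) : Prop :=
  (exists x y : X, x <> y) /\
  forall (Y : Type) (s : Y * Y -> Y * Y) (f : X -> Y),
    is_solution s -> sol_hom r s f -> (forall y, exists x, f x = y) ->
    bijective f \/ (forall x x', f x = f x').

(* Main.v *)
(** The relation sigma_j = sigma_l on indices is preserved by the maps d_{i,k},
    which act transitively by indecomposability; since p is prime and r is
    irretractable, the sigma_j are pairwise distinct, whence d_{i,k} = d_{k,i}
    and sigma_{d(j)} sigma_l = sigma_{d(l)} sigma_j for every d = d_{i,k}. Two
    different maps d, d' exist, again by irretractability, and g = d' d^-1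
    satisfies sigma_{g(j)} = c sigma_j for a fixed permutation c. The powers of g
    act freely, so g and c are p-cycles; in coordinates where both are the
    translation by 1 the sigma_j, and then the d_{i,k}, are affine. What remains
    of the braid relation says that the constant term of d_{i,k} is a function
    j_{k-i} with the stated symmetries.

    To see that r is simple, consider the fibres of a homomorphism f. They are
    invariant under the maps sigma_(a,0) sigma_(b,0)^-1, which translate each
    column vertically. If f identifies two points of a column, it collapses all
    columns and then everything. Otherwise, if f identifies any two points, then
    j_{x+e} - j_x does not depend on x for some e <> 0; since j is even this
    makes j constant or p = 2, and both are impossible. *)
Require Import Defs.
From HB Require Import structures.
From mathcomp Require Import all_boot all_order all_algebra all_fingroup.
From mathcomp Require Import ring.
From Stdlib Require Import Relations FunctionalExtensionality.
From Stdlib Require Import Classical ClassicalEpsilon.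
Set Implicit Arguments.
Unset Strict Implicit.
Unset Printing Implicit Defensive.
Import GRing.Theory.
Local Open Scope ring_scope.

(** * The braid relation and transport of solutions *)

(** This is the first component of the braid relation: injectivity of [S (S x y)] identifies [v]
    with the second component of [r (x, y)]. *)
Lemma braid_sigma (X : Type) (r : X * X -> X * X) (S : X -> X -> X) :
  (forall x y, (r (x, y)).1 = S x y /\ S (r (x, y)).1 (r (x, y)).2 = x) ->
  is_solution r ->
  forall x y v z, S (S x y) v = x -> S x (S y z) = S (S x y) (S v z).
Proof.
move=> rS [_ Sbij _ braid] x y v z Suv.
have r1 a b : (r (a, b)).1 = S a b by case: (rS a b).
have Sinj a : injective (S a).
  move=> b b' eqS; apply: (bij_inj (Sbij a)).
  by rewrite /ybe_sigma !r1.
have r2 : (r (x, y)).2 = v.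
  by apply: (Sinj (S x y)); rewrite Suv; have := (rS x y).2; rewrite r1.
have /(congr1 (fun u : X * X * X => u.1.1)) := braid (x, y, z).
by rewrite /r12 /r23 /= !r1 r2 => ->.
Qed.

Definition conj_sol (X Y : Type) (F : X -> Y) (G : Y -> X)
    (r : X * X -> X * X) (z : Y * Y) : Y * Y :=
  (F (r (G z.1, G z.2)).1, F (r (G z.1, G z.2)).2).

Lemma conj_sol_solution (X Y : Type) (F : X -> Y) (G : Y -> X) r :
  cancel F G -> cancel G F -> is_solution r -> is_solution (conj_sol F G r).
Proof.
move=> FK GK [rK Sbij Gbij braid].
have Fb : bijective F by exists G.
have Gb : bijective G by exists F.
split=> [[x y]|x|y|[[x y] z]].
- by rewrite /conj_sol /= !FK -surjective_pairing rK /= !GK.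
- exact: (bij_comp Fb (bij_comp (Sbij (G x)) Gb)).
- exact: (bij_comp Fb (bij_comp (Gbij (G y)) Gb)).
- pose F3 (u : X * X * X) := (F u.1.1, F u.1.2, F u.2).
  have e12 u : r12 (conj_sol F G r) (F3 u) = F3 (r12 r u).
    by rewrite /r12 /conj_sol /F3 /= !FK.
  have e23 u : r23 (conj_sol F G r) (F3 u) = F3 (r23 r u).
    by rewrite /r23 /conj_sol /F3 /= !FK.
  have -> : (x, y, z) = F3 (G x, G y, G z) by rewrite /F3 /= !GK.
  by rewrite !(e12, e23) braid.
Qed.

(** * Equivalences and permutations on sets of prime order *)

(** The common size of the classes divides the prime [#|T|], so it is 1 or [#|T|]. *)
Lemma prime_equivalence (T : finType) (E : rel T) :
  prime #|T| -> equivalence_rel E -> (forall x y, #|E x| = #|E y|) ->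
  (forall x y, E x y -> x = y) \/ (forall x y, E x y).
Proof.
move=> Tp Eeq Ecard.
have /card_gt0P[x0 _] := prime_gt0 Tp.
have part : partition (equivalence_partition E [set: T]) [set: T].
  by apply: equivalence_partitionP => x y z _ _ _; apply: Eeq.
have Erefl x : E x x by case: (Eeq x x x).
have uni : {in equivalence_partition E [set: T], forall A : {set T}, #|A| = #|E x0|}.
  move=> A /imsetP[x _ ->]; rewrite (Ecard x0 x).
  by apply: eq_card => y; rewrite !inE.
have := card_uniform_partition uni part; rewrite cardsT => cT.
have /(primeP Tp).2 : (#|E x0| %| #|T|)%N by rewrite cT dvdn_mull.
case/pred2P => cE; [left|right] => x y.
  move=> Exy.
  have /eq_leq/card_le1_eqP h : #|E x| = 1%N by rewrite (Ecard x x0).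
  by have := h y x Exy (Erefl x).
have /subset_cardP EP : #|E x| = #|T| by rewrite (Ecard x x0).
exact: (elimT EP (subset_predT _) y).
Qed.

Lemma Fp_ind (p : nat) (P : 'F_p -> Prop) :
  P 0 -> (forall x, P x -> P (x + 1)) -> forall x, P x.
Proof.
move=> P0 PS x; rewrite -[x]natr_Zp; elim: (nat_of_ord x) => // n IH.
by rewrite -addn1 natrD; apply: PS.
Qed.

Lemma Fp_shift (p : nat) (P : 'F_p -> Prop) (e : 'F_p) :
  e != 0 -> P 0 -> (forall x, P x -> P (x + e)) -> forall x, P x.
Proof.
move=> e0 P0 PS x; rewrite -[x](divfK e0); elim/Fp_ind: (x / e) => [|y IH].
  by rewrite mul0r.
by rewrite mulrDl mul1r; apply: PS.
Qed.

(** [A] runs along the orbit of a non-fixed point [x]; a repetition would give [A] a nonzero period,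
    making it constant and [x] fixed. *)
Lemma perm_translation (p : nat) (p_prime : prime p) (c : {perm 'F_p}) :
  (c ^+ p = 1)%g -> (c != 1)%g ->
  exists A : 'F_p -> 'F_p, bijective A /\ forall k, c (A k) = A (k + 1).
Proof.
move=> cp c1.
have [x cx] : exists x, c x != x.
  apply/existsP; apply: contraNT c1 => /existsPn h.
  by apply/eqP/permP => x; rewrite perm1; apply/eqP; have := h x; rewrite negbK.
pose A (k : 'F_p) := (c ^+ (k : nat))%g x.
have An n : A n%:R = (c ^+ n)%g x by rewrite /A val_Fp_nat // expg_mod.
have AS k : A (k + 1) = c (A k).
  by rewrite -{1}[k]natr_Zp natr1 An expgSr permM.
exists A; split=> // ; apply: injF_bij => a b eqA.
apply/eqP; rewrite -subr_eq0; apply/negPn/negP => ab.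
have per k : A (k + (a - b)) = A k.
  have -> : k = b + (k - b) by ring.
  have -> : b + (k - b) + (a - b) = a + (k - b) by ring.
  elim/Fp_ind: (k - b) => [|y IH]; first by rewrite !addr0.
  by rewrite !addrA !AS IH.
case/eqP: cx; have <- : A 0 = x by rewrite /A perm1.
rewrite -AS; apply: (Fp_shift (P := fun y => A y = A 0) ab) => // y.
exact: etrans (per y).
Qed.

(* The powers of [g] act freely, so the orbits of [g] all have the same length,
   which divides p. *)
Lemma free_perm_order (p : nat) (p_prime : prime p) (gT : finGroupType)
    (g : {perm 'F_p}) (s : 'F_p -> gT) (c : gT) :
  injective s -> (forall j, s (g j) = s j * c)%g -> (g != 1)%g ->
  (g ^+ p = 1)%g /\ (c ^+ p = 1)%g.
Proof.
move=> sinj sg g1.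
have sgX n j : (s ((g ^+ n)%g j) = s j * c ^+ n)%g.
  elim: n => [|n IH]; first by rewrite perm1 mulg1.
  by rewrite !expgSr permM sg IH mulgA.
(* One fixed point forces [c ^+ n = 1]; injectivity of [s] then makes every point fixed. *)
have free j n : (g ^+ n)%g j = j -> (g ^+ n = 1)%g.
  move=> gj; have cn : (c ^+ n = 1)%g.
    by apply: (mulgI (s j)); rewrite -sgX gj mulg1.
  by apply/permP=> k; apply: sinj; rewrite sgX cn mulg1 perm1.
have cardg x : #|porbit g x| = #[g]%g.
  have -> : porbit g x = orbit 'P <[g]> x by rewrite porbit.unlock.
  have := card_orbit_stab 'P <[g]>%G x.
  suff -> : ('C_<[g]>[x | 'P] = 1)%g by rewrite cards1 muln1.
  apply/eqP; rewrite eqEsubset sub1G andbT.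
  apply/subsetP => h /setIP[/cycleP[n ->]] /astab1P gx.
  by rewrite inE; apply/eqP/(free x).
suff ord : #[g]%g = p.
  have gp : (g ^+ p = 1)%g by have := expg_order g; rewrite ord.
  by split=> //; apply: (mulgI (s 0)); rewrite -sgX gp perm1 mulg1.
have [|||triv|full] := @prime_equivalence 'F_p (fun x y => y \in porbit g x).
- by rewrite card_Fp.
- move=> x y z; split; first exact: porbit_id.
  by rewrite porbit_sym -eq_porbit_mem => /eqP ->.
- by move=> x y; rewrite -[LHS]/#|porbit g x| !cardg.
- case/eqP: g1; apply/permP => x; rewrite perm1; apply/esym/triv.
  exact: (mem_porbit g 1 x).
- rewrite -(cardg 0) -[RHS](card_Fp p_prime).
  by apply: eq_card => y; rewrite full.
Qed.

Lemma difference_affine (p : nat) (tau : 'F_p -> 'F_p) (t : 'F_p) :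
  (forall x, tau (x + 1) = tau x + t) -> forall x, tau x = t * x + tau 0.
Proof.
move=> tauS; elim/Fp_ind => [|x IH]; first by rewrite mulr0 add0r.
by rewrite tauS IH; ring.
Qed.

(** * Linearising the first coordinate *)

Lemma sigma_injective (p : nat) (p_prime : prime p)
    (sig : 'F_p -> 'F_p -> 'F_p) (d : 'F_p -> 'F_p -> 'F_p -> 'F_p) :
  (forall j, injective (sig j)) -> (forall i k, injective (d i k)) ->
  (forall i k j l z, sig (d k i j) (sig l z) = sig (d i k l) (sig j z)) ->
  (forall j l, clos_refl_trans _
     (fun a b => exists i k, d i k a = b \/ d i k b = a) j l) ->
  ~ (forall j l, sig j =1 sig l) ->
  forall j l, sig j =1 sig l -> j = l.
Proof.
move=> sig_inj d_inj braid d_trans sig_var.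
pose E := [rel j l | [forall k, sig j k == sig l k]].
have EP j l : reflect (sig j =1 sig l) (E j l) by apply: eqfunP.
have d_eq i k j l : sig j =1 sig l -> sig (d k i j) =1 sig (d i k l).
  move=> eqjl y; have [s sK Ks] := injF_bij (sig_inj l).
  by rewrite -(Ks y) braid eqjl.
(* [d_eq] swaps the indices [i] and [k]; its case with equal last arguments swaps them back. *)
have Ed i k j l : E (d i k j) (d i k l) = E j l.
  apply/EP/EP => [eqd z|eqjl z].
    apply: (sig_inj (d i k l)).
    by rewrite -braid (d_eq i k j j) // eqd.
  by rewrite (d_eq k i j l eqjl) (d_eq i k l l).
have Ecard j l : #|E j| = #|E l|.
  elim: (d_trans j l) => // [a b [i [k dab]]|a b c _ IH _ IH'].
    wlog dab' : a b {dab} / d i k a = b.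
      by move=> H; case: dab => [/H|/H ->].
    rewrite -dab' -(card_image (d_inj i k)); apply: eq_card => y.
    have [s sK Ks] := injF_bij (d_inj i k).
    by rewrite -(Ks y) mem_image // [RHS]Ed.
  exact: etrans IH'.
have [||triv|full] := prime_equivalence (E := E) _ _ Ecard.
- by rewrite card_Fp.
- move=> x y z; split; first exact/EP.
  by move=> /EP exy; apply/EP/EP => e u; rewrite -e exy.
- by move=> j l ejl; apply/triv/EP.
- by case: sig_var => j l; exact: elimT (EP _ _) (full _ _).
Qed.

Lemma linear_coordinates (p : nat) (p_prime : prime p)
    (sig : 'F_p -> 'F_p -> 'F_p) (d : 'F_p -> 'F_p -> 'F_p -> 'F_p) :
  (forall j, injective (sig j)) -> (forall i k, injective (d i k)) ->
  (forall i k j l z, sig (d k i j) (sig l z) = sig (d i k l) (sig j z)) ->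
  (forall j l, sig j =1 sig l -> j = l) ->
  ~ (forall i i' k l, d i k l = d i' k l) ->
  exists (t : 'F_p) (A B : 'F_p -> 'F_p),
    [/\ t != 0, bijective A, bijective B &
        forall j k, sig (B j) (A k) = A (t * k + j)].
Proof.
move=> sig_inj d_inj braid sig_sep d_var.
have dC i k : d k i =1 d i k.
  move=> j; apply: sig_sep => y.
  have [s sK Ks] := injF_bij (sig_inj j).
  by rewrite -(Ks y) braid.
have {}braid i k j l z : sig (d i k j) (sig l z) = sig (d i k l) (sig j z).
  by rewrite -dC braid.
have [i [i' [k neq_d]]] : exists i i' k, ~ d i k =1 d i' k.
  apply: NNPP => all_eq; apply: d_var => i i' k l.
  by apply: NNPP => neq; apply: all_eq; exists i, i', k => /(_ l).
pose sp j : {perm 'F_p} := perm (sig_inj j).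
pose P : {perm 'F_p} := perm (d_inj i k).
pose Q : {perm 'F_p} := perm (d_inj i' k).
have sp_inj : injective sp.
  move=> j l /permP eqs; apply: sig_sep => z.
  by have := eqs z; rewrite !permE.
have spP j l : (sp l * sp (P j) = sp j * sp (P l))%g.
  by apply/permP => z; rewrite !permM !permE braid.
have spQ j l : (sp l * sp (Q j) = sp j * sp (Q l))%g.
  by apply/permP => z; rewrite !permM !permE braid.
(* By [spP] and [spQ], the product [(sp (P j))^-1 * sp (Q j)] does not depend on [j]; [c] is its
   value at 0. *)
pose c := ((sp (P 0))^-1 * sp (Q 0))%g.
pose g := (P^-1 * Q)%g.
have spg j : (sp (g j) = sp j * c)%g.
  rewrite permM; set l := (P^-1)%g j.
  have -> : j = P l by rewrite permKV.
  apply: (mulgI (sp 0)).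
  by rewrite spQ mulgA spP /c -!mulgA mulKVg.
have g1 : (g != 1)%g.
  apply/eqP => /(canRL (mulKg _)); rewrite mulg1 invgK => eqPQ.
  by apply: neq_d => l; have /permP/(_ l) := eqPQ; rewrite !permE.
have [gp cp] := free_perm_order p_prime sp_inj spg g1.
have c1 : (c != 1)%g.
  apply: contra g1 => /eqP c1; apply/eqP/permP => j.
  by apply: sp_inj; rewrite spg c1 mulg1 perm1.
have [B [Bbij gB]] := perm_translation p_prime gp g1.
have [A [Abij cA]] := perm_translation p_prime cp c1.
have [A' AK KA] := Abij; have [B' BK KB] := Bbij.
pose tau x := A' (sig (B 0) (A x)).
have sigAB n m : sig (B n) (A m) = A (tau m + n).
  elim/Fp_ind: n => [|n IH]; first by rewrite addr0 KA.
  rewrite -gB.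
  have := congr1 (fun s : {perm 'F_p} => s (A m)) (spg (B n)).
  by rewrite permM !(permE (sig_inj _)) IH cA addrA.
pose dt n := B' (d i k (B n)).
have tau_inj : injective tau.
  exact: inj_comp (inj_comp (can_inj KA) (sig_inj _)) (can_inj AK).
(* The braid relation for one fixed map [d i k], read in the new coordinates; [l = 1] and [j = 0]
   show that [tau] has constant increments. *)
have tau_diff x j l : tau (x + l) + dt j = tau (x + j) + dt l.
  have [tau' tauK Ktau] := injF_bij tau_inj.
  apply: (can_inj AK); have := braid i k (B j) (B l) (A (tau' x)).
  by rewrite -(KB (d i k (B j))) -(KB (d i k (B l))) !sigAB !Ktau.
pose t := dt 1 - dt 0.
have tauE x : tau x = t * x + tau 0.
  apply: difference_affine => {}x; apply: (addIr (dt 0)).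
  by rewrite tau_diff addr0 /t; ring.
(* Shifting the argument of [B] absorbs the constant term [tau 0]. *)
exists t, A, (fun j => B (j - tau 0)); split=> //.
- apply/eqP => t0; have := tauE 1; rewrite t0 mul0r add0r => /tau_inj/eqP.
  by rewrite oner_eq0.
- by apply: (bij_comp Bbij); exists (fun j => j + tau 0) => j; rewrite ?subrK ?addrK.
- by move=> j m; rewrite sigAB tauE; congr (A _); ring.
Qed.

(** * The constant terms of the maps [d i k] *)

(** Take [x = (i, d k i j)], [y = (m, l)] and [v = (m', j)]: the conditions on [m] and [m'] give
    [S x y = (k, d i k l)] and [S (S x y) v = x]. *)
Lemma skew_braid (F : Type) (sig : F -> F -> F) (d : F -> F -> F -> F) :
  (let S x y := (sig x.2 y.1, d x.1 (sig x.2 y.1) y.2) in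
   forall x y v z, S (S x y) v = x -> S x (S y z) = S (S x y) (S v z)) ->
  forall i k j l m m' a b,
    sig (d k i j) m = k -> sig (d i k l) m' = i ->
    sig (d k i j) (sig l a) = sig (d i k l) (sig j a) /\
    d i (sig (d k i j) (sig l a)) (d m (sig l a) b) =
      d k (sig (d i k l) (sig j a)) (d m' (sig j a) b).
Proof.
move=> /= braid i k j l m m' a b mk m'i.
have := braid (i, d k i j) (m, l) (m', j) (a, b).
by rewrite /= mk m'i => /(_ erefl) [-> ->].
Qed.

Lemma affine_solution_form (p : nat) (t : 'F_p) (d : 'F_p -> 'F_p -> 'F_p -> 'F_p) :
  t != 0 ->
  (let S x y := (t * y.1 + x.2, d x.1 (t * y.1 + x.2) y.2) in
   forall x y v z, S (S x y) v = x -> S x (S y z) = S (S x y) (S v z)) ->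
  exists g : 'F_p -> 'F_p,
    [/\ forall x, g (- x) = g x,
        forall x, g (t * x) = t * g x - (t - 1) * g 0 &
        forall i k l, d i k l = t * (l - g (k - i))].
Proof.
move=> t0 braid.
have tK x : t * (x / t) = x by field.
have br := @skew_braid _ (fun j k => t * k + j) d braid.
have br1 i k j l : t * l + d k i j = t * j + d i k l.
  have [||/= + _] := br i k j l ((k - d k i j) / t) ((i - d i k l) / t) 0 0.
  - by rewrite tK subrK.
  - by rewrite tK subrK.
  - by rewrite !mulr0 !add0r.
pose f i k := - (d i k 0 / t).
have dC i k j : d k i j = d i k j by have /addrI := br1 i k j j.
have fC i k : f k i = f i k by rewrite /f dC.
have df i k l : d i k l = t * (l - f i k).
  by have := br1 i k 0 l; rewrite mulr0 add0r => <-; rewrite dC /f; field.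
(* The arguments below are chosen so that the two [d]-values are [- t * u] and [- t * w], the inner
   first coordinates are [x + u] and [x + w], and both outer ones are [t * x]. *)
have key k i u w x :
    t * f (k + u) (x + u) - f (t * k) (t * x) =
    t * f (i + w) (x + w) - f (t * i) (t * x).
  pose e := f (t * i) (t * k).
  have [||/= _] := br (t * i) (t * k) (e - u) (e - w) (k + u) (i + w)
                   ((x + w + u - e) / t) 0.
  - by rewrite df fC -/e; ring.
  - by rewrite df -/e; ring.
  rewrite !tK !df (fC (t * i) (t * k)) -/e => eq2.
  have E1 : x + w + u - e + (e - w) = x + u by ring.
  have E2 : x + w + u - e + (e - u) = x + w by ring.
  rewrite E1 E2 in eq2.
  have E3 : t * (x + u) + t * (e - u - e) = t * x by ring.
  have E4 : t * (x + w) + t * (e - w - e) = t * x by ring.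
  rewrite E3 E4 in eq2.
  move/(mulfI t0): eq2 => eq2.
  move/eqP: eq2; rewrite -subr_eq0 => /eqP eq2; apply: subr0_eq.
  by rewrite -[RHS]oppr0 -eq2; ring.
have ftr k x u : f (k + u) (x + u) = f k x.
  have := key k k u 0 x; rewrite !addr0 => /addIr; exact: mulfI.
have fg k x : f k x = f 0 (x - k) by rewrite -(ftr k x (- k)) subrr.
exists (f 0); split=> [x|x|i k l].
- by rewrite -[RHS]fC [RHS]fg sub0r.
- have := key 0 x 0 0 x.
  rewrite !addr0 mulr0 [f x x]fg [f (t * x) (t * x)]fg !subrr => key0.
  by rewrite mulrBl mul1r -key0; ring.
- by rewrite df fg.
Qed.

(** * Simplicity of the affine model *)

Lemma Fp_char2 (p : nat) (p_prime : prime p) (x : 'F_p) :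
  (2%:R : 'F_p) = 0 -> x != 0 -> x = 1.
Proof.
move=> /(congr1 (fun y : 'F_p => y : nat)).
rewrite val_Fp_nat // => /eqP; rewrite -[_ == _]/(p %| 2)%N dvdn_prime2 // => /eqP p2.
subst p; case: x => [[|[|m]]] // im _; exact: val_inj.
Qed.

Lemma model_simple (p : nat) (p_prime : prime p) (t : 'F_p) (g : 'F_p -> 'F_p)
    (Y : Type) (act : Y -> Y -> Y) (f : 'F_p * 'F_p -> Y) :
  t != 0 -> (forall x, g (- x) = g x) -> (exists i k, g i != g k) ->
  (forall y, injective (act y)) ->
  (forall x y, f (t * y.1 + x.2, t * (y.2 - g (t * y.1 + x.2 - x.1))) =
               act (f x) (f y)) ->
  injective f \/ (forall x x', f x = f x').
Proof.
move=> t0 g_even [a0 [b0 gab]] act_inj hom.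
(* Identified points act alike after [f]; dividing by [t] indexes the result by the column reached
   from [k]. *)
have fS i j i' j' : f (i, j) = f (i', j') -> forall k l,
    f (k + j, l - t * g (k + j - i)) = f (k + j', l - t * g (k + j' - i')).
  move=> eqf k l.
  have := hom (i, j) (k / t, l / t); have := hom (i', j') (k / t, l / t).
  rewrite eqf /= => <-.
  have -> : t * (k / t) = k by field.
  have E u : t * (l / t - u) = l - t * u by field.
  by rewrite !E.
(* [phi b a] is the vertical translation sigma_(a,0) sigma_(b,0)^-1. *)
pose phi b a k := t * (g (k - b) - g (k - a)).
have V b a k l k' l' : f (k, l) = f (k', l') ->
    f (k, l + phi b a k) = f (k', l' + phi b a k').
  move=> eqf.
  (* The preimage of [(k, l)] under sigma_(b,0). *)
  pose y k l := (k / t, l / t + g (k - b)).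
  have eqy : f (y k l) = f (y k' l').
    apply: (act_inj (f (b, 0))); rewrite -!hom /= !addr0.
    have E u : t * (u / t) = u by field.
    by rewrite !E !addrK !E.
  have := congr1 (act (f (a, 0))) eqy; rewrite -!hom /= !addr0.
  have E u : t * (u / t) = u by field.
  have E' u v w : t * (u / t + v - w) = u + t * (v - w) by field.
  by rewrite !E !E'.
case: (classic (exists k l l', l <> l' /\ f (k, l) = f (k, l'))).
  case=> k [l [l' [/eqP ll' eqf]]]; right.
  (* With these indices the translation of column [k] is by [t * (g a0 - g b0)]. *)
  have w0 : phi (k - a0) (k - b0) k != 0.
    by rewrite /phi !subKr mulf_neq0 // subr_eq0.
  have step x : f (k, l + x) = f (k, l' + x).
    apply: (Fp_shift (P := fun x => f (k, l + x) = f (k, l' + x)) w0) => [|y IH].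
      by rewrite !addr0.
    by rewrite !addrA; apply: V.
  (* By [step], [l' - l] is a vertical period of [f] on column [k]. *)
  have col x : f (k, x) = f (k, 0).
    have e0 : l' - l != 0 by rewrite subr_eq0 eq_sym.
    apply: (Fp_shift (P := fun x => f (k, x) = f (k, 0)) e0) => // y <-.
    have := step (y - l).
    by rewrite addrC subrK => ->; congr (f (_, _)); ring.
  (* sigma_(0, i - t k) carries column [k] onto column [i]. *)
  have col' i x x' : f (i, x) = f (i, x').
    have := hom (0, i - t * k) (k, x / t + g i).
    rewrite (col (_ + _)) -(col (x' / t + g i)) -hom /= subr0.
    have -> : t * k + (i - t * k) = i by ring.
    by rewrite !addrK ![t * (_ / t)]mulrC !divfK.
  (* The points [(0, i)] and [(0, i')] of one column are identified, and their sigma maps send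
     column 0 to columns [i] and [i']. *)
  move=> [i j] [i' j']; rewrite (col' i j i) (col' i' j' i').
  have := fS 0 i 0 i' (col' 0 i i') 0 0; rewrite !add0r => eqc.
  by rewrite (col' i i (- (t * g (i - 0)))) (col' i' i' (- (t * g (i' - 0)))).
move=> nvert; left.
have vert k l l' : f (k, l) = f (k, l') -> l = l'.
  by move=> eqf; apply: NNPP => ll'; apply: nvert; exists k, l, l'.
have horiz i i' j : f (i, j) = f (i', j) -> i = i'.
  move=> eqf; apply: NNPP => /eqP ii'.
  have ii0 : i - i' != 0 by rewrite subr_eq0.
  have gper x : g (x + (i - i')) = g x.
    have := fS _ _ _ _ eqf (x + i - j) 0; rewrite subrK => /vert /addrI /oppr_inj /(mulfI t0).
    by rewrite addrK addrA => ->.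
  case/eqP: gab.
  have gc x : g x = g 0.
    by apply: (Fp_shift (P := fun x => g x = g 0) ii0) => // y; rewrite gper.
  by rewrite gc [RHS]gc.
move=> [i j] [i' j'] eqf.
have [eqi|/eqP ni] := eqVneq i i'.
  by subst i'; rewrite (vert _ _ _ eqf).
exfalso; have /eqP nj : j' - j != 0.
  by rewrite subr_eq0; apply/eqP => ej; apply: ni; subst j'; apply: horiz eqf.
set e := j' - j in nj.
have shift x l : f (x, l) = f (x + e, l + t * (g (x - i) - g (x + e - i'))).
  have := fS _ _ _ _ eqf (x - j) (l + t * g (x - i)).
  rewrite subrK addrK => ->.
  have -> : x - j + j' = x + e by rewrite /e; ring.
  by congr (f (_, _)); ring.
(* Translate both points of [shift x 0] by [phi 0 (x - y)]; since no column has identified points,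
   the two translations agree. *)
have gdiff x y : g (x + e) - g x = g (y + e) - g y.
  have := V 0 (x - y) x 0 _ _ (shift x 0).
  rewrite (shift x) => /vert; rewrite !add0r addrC => /addrI.
  rewrite /phi !subr0 => /(mulfI t0).
  have -> : x - (x - y) = y by ring.
  have -> : x + e - (x - y) = y + e by ring.
  move=> eqg; have -> : g (x + e) = g x - g y + g (y + e) by rewrite eqg subrK.
  by ring.
(* Evenness at the pair [0], [- e] makes the constant increment equal to its own negative. *)
have two : 2%:R * (g e - g 0) = 0.
  have := gdiff 0 (- e); rewrite add0r addNr g_even => eqg.
  have -> : 2%:R * (g e - g 0) = (g e - g 0) - (g 0 - g e) by ring.
  by rewrite eqg subrr.
have [/eqP|two0] := eqVneq (g e) (g 0).
  rewrite -subr_eq0 => /eqP ge; case/eqP: gab.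
  have gc x : g x = g 0.
    apply: (Fp_shift (P := fun x => g x = g 0)) => [|//|y <-].
      exact/eqP/nj.
    by apply/eqP; rewrite -subr_eq0 (gdiff y 0) add0r ge.
  by rewrite gc [RHS]gc.
have {}two : (2%:R : 'F_p) = 0.
  by move/eqP: two; rewrite mulf_eq0 subr_eq0 (negPf two0) orbF => /eqP.
have e1 : e = 1 by apply: Fp_char2 => //; apply/eqP.
(* In characteristic 2 both displacements are 1, so the vertical term of [shift 0 0] vanishes and
   [(0, 0)], [(1, 0)] are identified, against [horiz]. *)
have i1 : i' - i = 1.
  by apply: Fp_char2 => //; rewrite subr_eq0 eq_sym; apply/eqP.
have := shift 0 0; rewrite e1.
have -> : 0 + 1 - i' = 0 - i by rewrite -i1; ring.
rewrite subrr mulr0 addr0 add0r => /horiz/esym/eqP.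
by rewrite oner_eq0.
Qed.

(** * Integer powers of [t] and assembly of the theorem *)

Lemma inj_surj_bij (X Y : Type) (f : X -> Y) :
  injective f -> (forall y, exists x, f x = y) -> bijective f.
Proof.
move=> finj fsurj.
pose g y := proj1_sig (constructive_indefinite_description _ (fsurj y)).
have gK : cancel g f by move=> y; rewrite /g; case: constructive_indefinite_description.
by exists g => // x; apply: finj; rewrite gK.
Qed.

Lemma affine_expz (K : fieldType) (t : K) (g : K -> K) :
  t != 0 -> (forall x, g (t * x) = t * g x - (t - 1) * g 0) ->
  forall (x : K) (s : int), g (t ^ s * x) = t ^ s * g x - (t ^ s - 1) * g 0.
Proof.
move=> t0 gt.
have gn n x : g (t ^+ n * x) = t ^+ n * g x - (t ^+ n - 1) * g 0.
  elim: n => [|n IH]; first by rewrite expr0; rewrite !mul1r subrr mul0r subr0.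
  by rewrite exprS -mulrA gt IH; ring.
move=> x [n|n]; first exact: gn.
rewrite NegzE -exprnN; have tn0 : t ^+ n.+1 != 0 by rewrite expf_neq0.
(* A negative power follows by solving the positive case at [t ^- n.+1 * x]. *)
have := gn n.+1 (t ^- n.+1 * x); rewrite mulVKf // => ->.
by move: tn0; move: (t ^+ n.+1) => u u0; field.
Qed.

Theorem mainTheorem12 (p : nat) (p_prime : prime p)
  (r : 'F_p * 'F_p * ('F_p * 'F_p) -> 'F_p * 'F_p * ('F_p * 'F_p))
  (sig : 'F_p -> 'F_p -> 'F_p) (d : 'F_p -> 'F_p -> 'F_p -> 'F_p) :
  let Sg (x y : 'F_p * 'F_p) : 'F_p * 'F_p :=
    (sig x.2 y.1, d x.1 (sig x.2 y.1) y.2) in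
  (* r(x,y) = (Sg x y, Sg_{Sg x y}^{-1}(x)) *)
  (forall x y, (r (x, y)).1 = Sg x y /\ Sg (r (x, y)).1 (r (x, y)).2 = x) ->
  is_solution r -> indecomposable r -> irretractable r ->
  (exists (t : 'F_p) (jv : 'F_p -> 'F_p),
     [/\ t != 0,
         (forall i, jv i = jv (- i)),
         (forall (i : 'F_p) (s : int),
            jv (t ^ s * i) = t ^ s * jv i - (t ^ s - 1) * jv 0),
         (exists i k, i != k /\ jv i != jv k) &
         exists r' : 'F_p * 'F_p * ('F_p * 'F_p) -> 'F_p * 'F_p * ('F_p * 'F_p),
           let Sg' (x y : 'F_p * 'F_p) : 'F_p * 'F_p :=
             (t * y.1 + x.2, t * (y.2 - jv (t * y.1 + x.2 - x.1))) in
           [/\ (forall x y, (r' (x, y)).1 = Sg' x y /\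
                            Sg' (r' (x, y)).1 (r' (x, y)).2 = x),
               is_solution r' &
               exists f : 'F_p * 'F_p -> 'F_p * 'F_p, sol_iso r r' f]])
  /\ simple_solution r.
Proof.
move=> Sg rS r_sol r_ind r_irr.
have sigmaE x y : ybe_sigma r x y = Sg x y by case: (rS x y).
have Sg_bij x : bijective (Sg x).
  by have [_ + _ _] := r_sol => /(_ x)/eq_bij; apply=> y; apply: sigmaE.
have Sg_irr x y : Sg x =1 Sg y -> x = y.
  move=> eqS; apply: r_irr; apply: functional_extensionality => z.
  by rewrite !sigmaE.
have braid := braid_sigma rS r_sol.
(* First coordinates of preimages under [Sg (0, j)] show [sig j] onto; finiteness gives
   injectivity. *)
have sig_inj j : injective (sig j).
  have [G _ GK] := Sg_bij (0, j).
  have sK : cancel (fun m => (G (m, 0)).1) (sig j).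
    by move=> m; have [] := GK (m, 0).
  exact: (bij_inj (bij_can_bij (injF_bij (can_inj sK)) sK)).
have d_inj i k : injective (d i k).
  have [s _ Ks] := injF_bij (sig_inj 0).
  move=> l l' eqd; suff [] : (s k, l) = (s k, l') by [].
  by apply: (bij_inj (Sg_bij (i, 0))); rewrite /Sg /= Ks eqd.
have sig_braid i k j l z : sig (d k i j) (sig l z) = sig (d i k l) (sig j z).
  have [m _ Km] := injF_bij (sig_inj (d k i j)).
  have [m' _ Km'] := injF_bij (sig_inj (d i k l)).
  by case: (@skew_braid _ sig d braid _ _ _ _ _ _ z 0 (Km k) (Km' i)).
have d_trans j l : clos_refl_trans _
    (fun a b => exists i k, d i k a = b \/ d i k b = a) j l.
  (* On second coordinates each sigma map acts through some [d i k], so orbits project. *)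
  have to2 x y : clos_refl_trans _ (sigma_step r) x y ->
      clos_refl_trans _ (fun a b => exists i k, d i k a = b \/ d i k b = a) x.2 y.2.
    elim=> {x y} [x y [z zxy]|x|x y z _ IH _ IH'].
    - apply: rt_step; rewrite !sigmaE in zxy.
      by case: zxy => <-; [exists z.1, (sig z.2 x.1); left
                         |exists z.1, (sig z.2 y.1); right].
    - exact: rt_refl.
    - exact: rt_trans IH IH'.
  exact: to2 (r_ind (0, j) (0, l)).
have sig_var : ~ (forall j l, sig j =1 sig l).
  move=> eqsig; have [/eqP] : (0, 0) = (0, 1) :> 'F_p * 'F_p.
    by apply: Sg_irr => z; rewrite /Sg /= (eqsig 0 1).
  by rewrite eq_sym oner_eq0.
have d_var : ~ (forall i i' k l, d i k l = d i' k l).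
  move=> eqd; have [/eqP] : (0, 0) = (1, 0) :> 'F_p * 'F_p.
    by apply: Sg_irr => z; rewrite /Sg /= (eqd 0 1).
  by rewrite eq_sym oner_eq0.
have sig_sep := sigma_injective p_prime sig_inj d_inj sig_braid d_trans sig_var.
have [t [A [B [t0 [A' AK KA] [B' BK KB] sigAB]]]] :=
  linear_coordinates p_prime sig_inj d_inj sig_braid sig_sep d_var.
pose F (x : 'F_p * 'F_p) := (A' x.1, B' x.2).
pose G (x : 'F_p * 'F_p) := (A x.1, B x.2).
have FK : cancel F G by move=> [x y]; rewrite /F /G /= KA KB.
have GK : cancel G F by move=> [x y]; rewrite /F /G /= AK BK.
pose r' := conj_sol F G r.
have r'_sol : is_solution r' by apply: conj_sol_solution.
pose d' i k l := B' (d (A i) (A k) (B l)).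
pose S' (x y : 'F_p * 'F_p) := (t * y.1 + x.2, d' x.1 (t * y.1 + x.2) y.2).
have S'E x y : S' x y = F (Sg (G x) (G y)).
  by rewrite /S' /F /Sg /= sigAB AK.
have r'S x y : (r' (x, y)).1 = S' x y /\ S' (r' (x, y)).1 (r' (x, y)).2 = x.
  have [r1 r2] := rS (G x) (G y).
  by rewrite !S'E /r' /conj_sol /= !FK r2 r1 GK.
have [g [g_even gt d'E]] := affine_solution_form t0 (braid_sigma r'S r'_sol).
pose Sg' (x y : 'F_p * 'F_p) : 'F_p * 'F_p :=
  (t * y.1 + x.2, t * (y.2 - g (t * y.1 + x.2 - x.1))).
have SgE x y : Sg' x y = S' x y by rewrite /S' d'E.
(* A constant [g] would make [d i k] independent of [i]. *)
have g_var : exists i k, g i != g k.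
  apply: NNPP => gc; apply: d_var => i i' k l.
  have eqd : d' (A' i) (A' k) (B' l) = d' (A' i') (A' k) (B' l).
    rewrite !d'E; congr (t * (_ - _)); apply/eqP/negPn/negP => neq.
    by apply: gc; exists (A' k - A' i), (A' k - A' i').
  by move/(can_inj KB): eqd; rewrite !KA !KB.
split.
  exists t, g; split=> //.
  - exact: affine_expz.
  - have [i [k gik]] := g_var; exists i, k; split=> //.
    by apply: contraNneq gik => ->.
  exists r'; split=> //.
    by move=> x y; rewrite -/(Sg' x y) -/(Sg' _ _) !SgE.
  exists F; split; first by exists G.
  by move=> x y; rewrite sigmaE /ybe_sigma (r'S _ _).1 S'E !FK.
split; first by exists (0, 0), (1, 0) => -[/eqP]; rewrite eq_sym oner_eq0.
move=> Y s f [_ s_bij _ _] f_hom f_surj.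
have [||finj|fconst] := model_simple (f := fun x => f (G x)) (act := ybe_sigma s)
  p_prime t0 g_even g_var.
- by move=> y; apply: bij_inj.
- by move=> x y; rewrite -/(Sg' x y) SgE S'E FK -sigmaE f_hom.
- left; apply: inj_surj_bij f_surj => x y.
  by rewrite -{1}(FK x) -{1}(FK y) => /finj /(can_inj FK).
- by right=> x y; rewrite -(FK x) -(FK y).
Qed.
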